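(* Let $G$ be a connected graph with two distinct marked vertices $x,y$, and for $n\ge 3$ let $F_n(G)=F_n(G,x,y)$ be the generalized flower graph. Let $M_n=\max_{u,v\in V(F_n(G))} r_{F_n(G)}(u,v)$ be the largest effective resistance between two vertices of $F_n(G)$. Then $$\lim_{n\to\infty}\left[M_{n+1}-M_n\right]=\tfrac14\, r_G(x,y).$$
   Context: For a connected graph $H$ with vertex set $\{1,\dots,N\}$ and Laplacian matrix $L$, the resistance distance (effective resistance) between vertices $i,j$ is $r_H(i,j)=(e_i-e_j)^T L^\dagger (e_i-e_j)$, where $e_i$ is the $i$th standard unit vector and $L^\dagger$ is the Moore–Penrose pseudoinverse of $L$. Generalized flower graph: let $G$ be a graph, $x\ne y$ two vertices of $G$, and $n\ge 3$. $F_n(G,x,y)$ (written $F_n(G)$) is the graph obtained by taking $n$ vertex-disjoint copies $G_1,\dots,G_n$ of $G$ (the petals), with $x_i,y_i$ the copies of $x,y$ in $G_i$, and identifying $y_i$ with $x_{i+1}$ for $1\le i<n$ and $y_n$ with $x_1$. *)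

(* Defs.v *)
From mathcomp Require Import all_boot all_order all_algebra.
From HB Require Import structures.
From mathcomp Require Import boolp classical_sets reals.
From mathcomp Require Import topology normedtype sequences.

Set Implicit Arguments.
Unset Strict Implicit.
Unset Printing Implicit Defensive.

Import Order.TTheory GRing.Theory Num.Theory.
Import numFieldNormedType.Exports.

Local Open Scope ring_scope.
Local Open Scope quotient_scope.

(* A finite simple graph is a symmetric irreflexive relation on a finType. *)
Definition simple_graph (V : finType) (e : rel V) : Prop :=
  symmetric e /\ irreflexive e.

Definition connected_graph (V : finType) (e : rel V) : Prop :=
  forall u v : V, connect e u v.

Definition penrose (R : realFieldType) (m n : nat)
    (A : 'M[R]_(m, n)) (X : 'M[R]_(n, m)) : Prop :=
  [/\ A *m X *m A = A, X *m A *m X = X,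
      (A *m X)^T = A *m X & (X *m A)^T = X *m A].

(* [penrose_mp_inverse] and [penrose_unique] below show that this choice is
   the only solution of the four Penrose equations. *)
Definition mp_inverse (R : realFieldType) (m n : nat) (A : 'M[R]_(m, n)) :
    'M[R]_(n, m) :=
  xget 0 [set X | penrose A X]%classic.

Section PenroseTheory.
Variable R : realFieldType.

Lemma penrose_unique m n (A : 'M[R]_(m, n)) (X Y : 'M[R]_(n, m)) :
  penrose A X -> penrose A Y -> X = Y.
Proof.
move=> [x1 x2 x3 x4] [y1 y2 y3 y4].
have AXY : A *m X = A *m Y.
  rewrite -x3 -{1}y1 -(mulmxA (A *m Y)) trmx_mul x3 y3.
  by rewrite mulmxA x1.
have XAY : X *m A = Y *m A.
  rewrite -x4 -{1}y1 -[A *m Y *m A]mulmxA mulmxA trmx_mul x4 y4.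
  by rewrite -mulmxA [A *m (X *m A)]mulmxA x1.
by rewrite -x2 -mulmxA AXY mulmxA XAY y2.
Qed.

Lemma mul_trmx_eq0 n (u : 'rV[R]_n) : u *m u^T = 0 -> u = 0.
Proof.
move=> /matrixP/(_ 0 0); rewrite !mxE => /eqP.
rewrite psumr_eq0 => [/allP u0|i _]; last by rewrite mxE -expr2 sqr_ge0.
apply/rowP => j; have := u0 j (mem_index_enum _).
by rewrite !mxE -expr2 /= sqrf_eq0 => /eqP.
Qed.

Lemma row_free_gram m n (F : 'M[R]_(m, n)) :
  row_free F -> F *m F^T \in unitmx.
Proof.
move=> Ffree; rewrite -row_free_unit -kermx_eq0; apply/eqP/row_matrixP => i.
rewrite row0; set u := row i _.
have: u *m (F *m F^T) = 0 by rewrite -row_mul mulmx_ker row0.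
move=> uFF; apply: (row_free_inj Ffree); rewrite mul0mx.
by apply: mul_trmx_eq0; rewrite trmx_mul mulmxA -(mulmxA u) uFF mul0mx.
Qed.

Lemma penrose_factor m r n (C : 'M[R]_(m, r)) (F : 'M[R]_(r, n)) :
  C^T *m C \in unitmx -> F *m F^T \in unitmx ->
  penrose (C *m F) (F^T *m invmx (F *m F^T) *m invmx (C^T *m C) *m C^T).
Proof.
move=> CC FF; set P := invmx (F *m F^T); set Q := invmx (C^T *m C).
have AX : C *m F *m (F^T *m P *m Q *m C^T) = C *m Q *m C^T.
  by rewrite !mulmxA -(mulmxA C F) -(mulmxA C _ P) mulmxV // mulmx1.
have XA : F^T *m P *m Q *m C^T *m (C *m F) = F^T *m P *m F.
  rewrite -!mulmxA (mulmxA C^T) (mulmxA Q) mulVmx // mul1mx //.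
have PT : P^T = P by rewrite /P trmx_inv trmx_mul trmxK.
have QT : Q^T = Q by rewrite /Q trmx_inv trmx_mul trmxK.
split.
- by rewrite AX -!mulmxA (mulmxA C^T) (mulmxA Q) mulVmx // mul1mx.
- by rewrite XA -!mulmxA (mulmxA F) (mulmxA P) mulVmx // mul1mx.
- by rewrite AX !trmx_mul trmxK QT mulmxA.
- by rewrite XA !trmx_mul trmxK PT mulmxA.
Qed.

Lemma penrose_exists m n (A : 'M[R]_(m, n)) : exists X, penrose A X.
Proof.
have FF := row_free_gram (row_base_free A).
have CC : (col_base A)^T *m col_base A \in unitmx.
  rewrite -{2}[col_base A]trmxK; apply: row_free_gram.
  by rewrite /row_free mxrank_tr; apply: col_base_full.
by have := penrose_factor CC FF; rewrite mulmx_base; move: (_ *m _) => X; exists X.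
Qed.

Lemma penrose_mp_inverse m n (A : 'M[R]_(m, n)) : penrose A (mp_inverse A).
Proof. by have [X AX] := penrose_exists A; apply: (xgetPex 0); exists X. Qed.

End PenroseTheory.

Definition laplacian (R : realFieldType) (V : finType) (e : rel V) :
    'M[R]_#|V| :=
  \matrix_(i, j) (#|e (enum_val i)|%:R *+ (i == j)
                  - (e (enum_val i) (enum_val j))%:R).

Definition unit_vec (R : realFieldType) (V : finType) (u : V) : 'cV[R]_#|V| :=
  delta_mx (enum_rank u) 0.

Definition resistance (R : realFieldType) (V : finType) (e : rel V)
    (u v : V) : R :=
  let d := unit_vec R u - unit_vec R v in
  (d^T *m mp_inverse (laplacian R e) *m d) 0 0.

Lemma resistance_xx (R : realFieldType) (V : finType) (e : rel V) (u : V) :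
  resistance R e u u = 0.
Proof. by rewrite /resistance subrr mulmx0 mxE. Qed.

(* The neutral element 0 is one of the values of the maximum, since
   [resistance R e u u = 0]; it is the actual maximum as soon as [V] is
   nonempty. *)
Definition max_resistance (R : realFieldType) (V : finType) (e : rel V) : R :=
  \big[Num.max/0]_(p : V * V) resistance R e p.1 p.2.

Section Flower.
Variables (T : finType) (e : rel T) (x y : T) (n : nat).

(* [(i, v)] is the copy of [v] in the [i]-th petal; [ordS] is the cyclic
   successor on ['I_n]. *)
Definition flower_glue : rel ('I_n * T) :=
  fun p q => (p.2 == y) && (q == (ordS p.1, x)).

Definition flower_eqv : rel ('I_n * T) :=
  connect (fun p q => flower_glue p q || flower_glue q p).

Lemma flower_eqv_refl : reflexive flower_eqv.
Proof. by move=> p; apply: connect0. Qed.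

Lemma flower_eqv_sym : symmetric flower_eqv.
Proof. by apply: sym_connect_sym => p q; rewrite orbC. Qed.

Lemma flower_eqv_trans : transitive flower_eqv.
Proof. exact: connect_trans. Qed.

Canonical flower_equiv :=
  EquivRel flower_eqv flower_eqv_refl flower_eqv_sym flower_eqv_trans.

Definition flower_vertex : Type := {eq_quot flower_equiv}.

HB.instance Definition _ := EqQuotient.on flower_vertex.
HB.instance Definition _ :=
  Finite.copy flower_vertex (can_type (@EquivQuot.ereprK _ _ _ _ _ flower_equiv)).


Definition flower_pi (p : 'I_n * T) : flower_vertex := \pi_flower_vertex p.

Lemma flower_piP (p q : 'I_n * T) :
  reflect (flower_pi p = flower_pi q) (flower_eqv p q).
Proof. exact: (@eqmodP _ flower_equiv p q). Qed.

Lemma flower_pi_glue (i : 'I_n) : flower_pi (i, y) = flower_pi (ordS i, x).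
Proof. by apply/flower_piP/connect1; rewrite /flower_glue !eqxx. Qed.

Lemma flower_pi_surj (a : flower_vertex) : exists p, a = flower_pi p.
Proof. by exists (repr a); rewrite /flower_pi reprK. Qed.

(* For [x != y], [e] simple and [3 <= n] no loop is created and no two edges
   become parallel, so this relation loses nothing of the glued graph. *)
Definition flower_edge : rel flower_vertex := fun a b =>
  [exists i : 'I_n, exists u : T, exists v : T,
    [&& e u v, a == flower_pi (i, u) & b == flower_pi (i, v)]].

End Flower.

(* Main.v *)
(* The resistance r(u, v) equals h u - h v for any h whose Dirichlet form
   against every test function f is f u - f v, i.e. whose Laplacian is
   e_u - e_v. The Dirichlet form of the flower is the sum of the forms of its
   petals, so potentials on the flower are glued from potentials on G, up to a
   circulation around the ring that makes the potential drops sum to 0.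

   With r = r_G(x, y) this gives, for u and v in distinct petals,
   r(u, v) = leg u + leg v + s - s^2 / (n r), where s is the resistance along
   one of the two arcs of the ring; the last two terms are at most n r / 4.
   Taking both u and v to be copies of a vertex with the largest leg, in petals
   at distance n/2 (rounded down), comes within r / (4 n) of that bound. Hence
   M_n - n r / 4 converges, and consecutive differences of M_n tend to r / 4. *)
Require Import Defs.
From mathcomp Require Import all_boot all_order all_algebra.
From mathcomp Require Import boolp classical_sets reals.
From mathcomp Require Import topology normedtype sequences.
From mathcomp Require Import ring lra zify.

Import GRing.Theory Num.Theory numFieldNormedType.Exports.
Import Order.TTheory.

Local Open Scope ring_scope.
Local Open Scope classical_set_scope.

Set Implicit Arguments.
Unset Strict Implicit.
Unset Printing Implicit Defensive.

(** * Dirichlet form and effective resistance on an arbitrary finite graph *)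

Section Dirichlet.
Variables (R : realFieldType) (V : finType) (e : rel V).
Implicit Types (f g h : V -> R) (u v : V).

(** The sum runs over ordered pairs, so each edge of a simple graph occurs twice; [2^-1] corrects
    this. *)
Definition dirichlet f g : R :=
  2^-1 * \sum_(p : V * V | e p.1 p.2) (f p.1 - f p.2) * (g p.1 - g p.2).

Lemma dirichletC f g : dirichlet f g = dirichlet g f.
Proof. by congr (_ * _); apply: eq_bigr => p _; rewrite mulrC. Qed.

Lemma dirichlet_affinel c k f g h :
  dirichlet (fun a => c * f a + g a + k) h = c * dirichlet f h + dirichlet g h.
Proof.
rewrite /dirichlet mulrCA -mulrDr; congr (_ * _).
rewrite mulr_sumr -big_split /=.
by apply: eq_bigr => p _; ring.
Qed.

Lemma dirichlet_comb3l c1 c2 c3 f1 f2 f3 g :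
  dirichlet (fun a => c1 * f1 a + c2 * f2 a + c3 * f3 a) g =
  c1 * dirichlet f1 g + c2 * dirichlet f2 g + c3 * dirichlet f3 g.
Proof.
rewrite /dirichlet !(mulrCA _ 2^-1) -!mulrDr; congr (_ * _).
rewrite !mulr_sumr -!big_split /=.
by apply: eq_bigr => p _; ring.
Qed.

Lemma dirichlet_cstl c g : dirichlet (fun=> c) g = 0.
Proof.
by rewrite /dirichlet big1 ?mulr0 // => p _; rewrite subrr mul0r.
Qed.

Lemma dirichlet_ge0 f : 0 <= dirichlet f f.
Proof.
by rewrite mulr_ge0 ?invr_ge0 // sumr_ge0 // => p _; rewrite -expr2 sqr_ge0.
Qed.

Lemma dirichlet_eq0 f u v : dirichlet f f = 0 -> e u v -> f u = f v.
Proof.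
move=> /eqP; rewrite mulf_eq0 invr_eq0 pnatr_eq0 /= psumr_eq0 => [|p _]; last first.
  by rewrite -expr2 sqr_ge0.
move=> /allP/(_ (u, v) (mem_index_enum _)) /implyP H uv.
by move: (H uv) => /=; rewrite -expr2 sqrf_eq0 subr_eq0 => /eqP.
Qed.

Definition fcol f : 'cV[R]_#|V| := \col_i f (enum_val i).

Lemma fcolK (w : 'cV[R]_#|V|) : fcol (fun a => w (enum_rank a) 0) = w.
Proof. by apply/matrixP => i j; rewrite !mxE enum_valK ord1. Qed.

Lemma mul_fcol f g : ((fcol f)^T *m fcol g) 0 0 = \sum_a f a * g a.
Proof.
rewrite mxE (reindex_onto enum_rank enum_val) /= => [|i _]; last exact: enum_valK.
rewrite (eq_bigl xpredT) => [|a]; last by rewrite enum_rankK eqxx.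
by apply: eq_bigr => a _; rewrite !mxE enum_rankK.
Qed.

Lemma mul_fcol_unit_vec f u : ((fcol f)^T *m unit_vec R u) 0 0 = f u.
Proof.
rewrite mxE (bigD1 (enum_rank u)) //= !mxE !eqxx enum_rankK mulr1.
by rewrite big1 ?addr0 // => i iu; rewrite !mxE (negPf iu) mulr0.
Qed.

Lemma mul_fcol_unit_vecB f u v :
  ((fcol f)^T *m (unit_vec R u - unit_vec R v)) 0 0 = f u - f v.
Proof.
by rewrite -!mul_fcol_unit_vec mulmxBr [LHS]mxE; congr (_ + _); rewrite [LHS]mxE.
Qed.

Lemma mul_laplacian_fcol f :
  laplacian R e *m fcol f = fcol (fun a => \sum_(b | e a b) (f a - f b)).
Proof.
apply/matrixP => i j; rewrite !mxE; set a := enum_val i.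
rewrite sumrB sumr_const.
transitivity (\sum_k (#|e a|%:R *+ (i == k) * f (enum_val k)
                      - (e a (enum_val k))%:R * f (enum_val k))).
  by apply: eq_bigr => k _; rewrite !mxE mulrBl.
rewrite sumrB; congr (_ - _).
  rewrite (bigD1 i) //= eqxx mulr1n mulr_natl big1 ?addr0 // => k.
  by rewrite eq_sym => /negPf ->; rewrite mul0r.
rewrite (reindex_onto enum_rank enum_val) /= => [|k _]; last exact: enum_valK.
rewrite [RHS]big_mkcond; apply: eq_big => [b|b _]; first by rewrite enum_rankK eqxx.
by rewrite enum_rankK; case: (e a b); rewrite ?mul1r ?mul0r.
Qed.

Hypothesis e_sym : symmetric e.

Lemma laplacian_sym : (laplacian R e)^T = laplacian R e.
Proof.
apply/matrixP => i j; rewrite !mxE e_sym eq_sym.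
by case: eqP => [->|_]; rewrite ?mulr0n.
Qed.

(** Summation by parts: by symmetry of [e], both ends of the edges contribute equally. *)
Lemma dirichlet_laplacian f g :
  ((fcol g)^T *m (laplacian R e *m fcol f)) 0 0 = dirichlet f g.
Proof.
rewrite mul_laplacian_fcol mul_fcol.
have E : \sum_a g a * (\sum_(b | e a b) (f a - f b)) =
    \sum_(p | e p.1 p.2) g p.1 * (f p.1 - f p.2).
  rewrite -(pair_big_dep xpredT e (fun a b => g a * (f a - f b))) /=.
  by apply: eq_bigr => a _; rewrite mulr_sumr.
have E' : \sum_(p | e p.1 p.2) g p.1 * (f p.1 - f p.2) =
    \sum_(p | e p.1 p.2) - (g p.2 * (f p.1 - f p.2)).
  rewrite (reindex_inj (h := fun p : V * V => (p.2, p.1))) /=; last first.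
    by move=> [a b] [c d] [-> ->].
  by apply: eq_big => [[a b]|[a b] _] /=; [rewrite e_sym | ring].
rewrite E /dirichlet; apply: (@mulfI _ 2); rewrite ?pnatr_eq0 // mulVKf ?pnatr_eq0 //.
rewrite mulr_natl mulr2n {2}E' -big_split /=.
by apply: eq_bigr => p _; ring.
Qed.

Definition potential u v h :=
  forall f, dirichlet h f = f u - f v.

(** Zero energy would make [h] constant along edges, so its form against the indicator of [u] would
    be 0 instead of 1. *)
Lemma potential_dirichlet_gt0 u v h :
  u != v -> potential u v h -> 0 < dirichlet h h.
Proof.
move=> uv uvh; rewrite lt0r dirichlet_ge0 andbT; apply/eqP => hh0.
have := uvh (fun a => (a == u)%:R).
rewrite eqxx eq_sym (negPf uv) subr0 /dirichlet big1 ?mulr0 => [/eqP|p hp].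
  by rewrite eq_sym oner_eq0.
by rewrite (dirichlet_eq0 hh0 hp) subrr mul0r.
Qed.

Lemma potential_laplacian u v h :
  potential u v h -> laplacian R e *m fcol h = unit_vec R u - unit_vec R v.
Proof.
move=> uvh; apply/matrixP => i j; rewrite ord1.
pose f a : R := (a == enum_val i)%:R.
have fi (w : 'cV[R]_#|V|) : ((fcol f)^T *m w) 0 0 = w i 0.
  rewrite mxE (bigD1 i) //= !mxE /f eqxx mul1r big1 ?addr0 // => k ki.
  by rewrite !mxE (inj_eq enum_val_inj) (negPf ki) mul0r.
have := uvh f; rewrite -dirichlet_laplacian fi => ->.
by rewrite -fi mul_fcol_unit_vecB.
Qed.

(** As [h] solves L h = e_u - e_v, symmetry of L and L X L = L reduce the quadratic form to h^T L
    h. *)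
Lemma resistance_potential u v h :
  potential u v h -> resistance R e u v = h u - h v.
Proof.
move=> uvh; rewrite /resistance -(potential_laplacian uvh).
have [LXL _ _ _] := penrose_mp_inverse (laplacian R e).
rewrite trmx_mul laplacian_sym -uvh -dirichlet_laplacian.
by rewrite -[in RHS]LXL !mulmxA.
Qed.

Lemma resistanceC u v : resistance R e u v = resistance R e v u.
Proof.
rewrite /resistance -(opprB (unit_vec R v)).
by rewrite [(- _)^T]linearN /= !mulNmx mulmxN opprK.
Qed.

(** The residue [w] of [d] after projection onto the range of [L] lies in the kernel of [L], hence
    is constant by connectedness; its entries sum to 0, so it vanishes and [X *m d] is a
    solution. *)
Lemma potential_exists u v : connected_graph e -> exists h, potential u v h.
Proof.
move=> e_conn; pose L := laplacian R e; pose d := unit_vec R u - unit_vec R v.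
have [LXL _ LXs _] := penrose_mp_inverse L; set X := mp_inverse L in LXL LXs.
pose w := d - L *m X *m d; pose f a := w (enum_rank a) 0.
have fw : fcol f = w by exact: fcolK.
have Lw : L *m w = 0.
  have LLX : L *m (L *m X) = L.
    by rewrite -LXs -[X in X *m _]laplacian_sym -trmx_mul LXL laplacian_sym.
  by rewrite mulmxBr mulmxA LLX subrr.
have f_const a b : f a = f b.
  have /connectP[p + ->] := e_conn a b.
  elim: p a => //= c p IHp a /andP[ac cp].
  rewrite -(IHp _ cp); apply: dirichlet_eq0 ac.
  by rewrite -dirichlet_laplacian fw Lw mulmx0 mxE.
have w0 : w = 0.
  pose one (a : V) : R := 1.
  have s0 : \sum_a one a * f a = 0.
    have L1 : (fcol one)^T *m L = 0.
      rewrite -[L]laplacian_sym -trmx_mul mul_laplacian_fcol.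
      by apply/matrixP => i j; rewrite !mxE big1 // => k _; rewrite subrr.
    rewrite -mul_fcol fw mulmxBr -mulmxA [_ *m (L *m _)]mulmxA L1 mul0mx subr0.
    by rewrite mul_fcol_unit_vecB subrr.
  apply/matrixP => i j; rewrite -fw !mxE; apply/eqP.
  move: s0; rewrite (eq_bigr (fun=> f (enum_val i))) => [|a _]; last first.
    by rewrite mul1r; apply: f_const.
  rewrite sumr_const => /eqP; rewrite mulrn_eq0 => /orP[|//].
  by rewrite eqn0Ngt (leq_ltn_trans _ (ltn_ord i)).
exists (fun a => (X *m d) (enum_rank a) 0) => g.
rewrite -dirichlet_laplacian fcolK (mulmxA (laplacian R e)) -/L.
have -> : L *m X *m d = d by apply/esym/eqP; rewrite -subr_eq0; apply/eqP.
by rewrite mul_fcol_unit_vecB.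
Qed.

End Dirichlet.

(** * Dirichlet form of the flower and gluing of potentials *)

Section FlowerForm.
Variables (R : realFieldType) (T : finType) (e : rel T) (x y : T) (n : nat).
Hypotheses (e_irr : irreflexive e) (e_sym : symmetric e) (xy : x != y).
Hypothesis n3 : (3 <= n)%N.

Local Notation pi i v := (@flower_pi T x y n (i, v)).
Local Notation flower_edge_n := (@flower_edge T e x y n).

Lemma flower_lift (W : Type) (F : 'I_n * T -> W) :
  (forall i, F (i, y) = F (ordS i, x)) ->
  forall p q, flower_pi x y p = flower_pi x y q -> F p = F q.
Proof.
move=> Fglue p q /flower_piP/connectP[s + ->].
elim: s p => //= r s IHs p /andP[pr rs]; rewrite -(IHs _ rs).
have step a b : flower_glue x y a b -> F a = F b.
  by case: a => i v /andP[/= /eqP -> /eqP ->].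
by case/orP: pr => [|/step ->//]; apply: step.
Qed.

Lemma ordS_neq (i : 'I_n) : (ordS i != i) && (ordS (ordS i) != i).
Proof.
rewrite -!val_eqE /=; have := ltn_ord i => i_n.
have [E|E] : (i.+1 < n \/ i.+1 = n)%N by lia.
  rewrite (modn_small E); have [F|F] : (i.+2 < n \/ i.+2 = n)%N by lia.
    by rewrite (modn_small F); lia.
  by rewrite F modnn; lia.
by rewrite E modnn modn_small; lia.
Qed.

Lemma flower_pi_edge_inj (i j : 'I_n) (u v u' v' : T) :
  e u v -> e u' v' -> pi i u = pi j u' -> pi i v = pi j v' ->
  [/\ i = j, u = u' & v = v'].
Proof.
move=> uv uv'.
(* [K] is a normal form for glued vertices: a copy of [y] becomes the copy of [x] in the next petal.
   Comparing normal forms of both ends leaves only coincidences excluded by [e_irr] or, through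
   [ordS_neq], by [n3]. *)
pose K (p : 'I_n * T) := if p.2 == y then (ordS p.1, x) else p.
have Kglue k : K (k, y) = K (ordS k, x) by rewrite /K /= eqxx (negPf xy).
move=> /(flower_lift Kglue) + /(flower_lift Kglue); rewrite /K /=.
have /andP[/eqP Si /eqP SSi] := ordS_neq i.
have /andP[/eqP Sj /eqP SSj] := ordS_neq j.
have [?|_] := eqVneq u y; have [?|_] := eqVneq u' y;
have [?|_] := eqVneq v y; have [?|_] := eqVneq v' y; subst;
  try (by rewrite e_irr in uv); try (by rewrite e_irr in uv');
  by move=> E E'; first [congruence | split; congruence].
Qed.

Lemma flower_edge_sym : symmetric flower_edge_n.
Proof.
suff sub a b : flower_edge_n a b -> flower_edge_n b a.
  by move=> a b; apply/idP/idP; apply: sub.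
move=> /existsP[i /existsP[u /existsP[v /and3P[uv au bv]]]].
apply/existsP; exists i; apply/existsP; exists v; apply/existsP; exists u.
by rewrite e_sym uv au bv.
Qed.

Lemma dirichlet_flower (f g : flower_vertex x y n -> R) :
  dirichlet flower_edge_n f g =
  \sum_i dirichlet e (fun v => f (pi i v)) (fun v => g (pi i v)).
Proof.
rewrite -mulr_sumr; congr (_ * _).
pose h (t : 'I_n * (T * T)) := (pi t.1 t.2.1, pi t.1 t.2.2).
pose A := [pred t : 'I_n * (T * T) | e t.2.1 t.2.2].
rewrite (pair_big_dep xpredT (fun _ p => e p.1 p.2)
  (fun i p => (f (pi i p.1) - f (pi i p.2)) * (g (pi i p.1) - g (pi i p.2)))) /=.
pose G p := (f p.1 - f p.2) * (g p.1 - g p.2).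
have h_inj : {in A &, injective h}.
  move=> [i [u v]] [j [u' v']]; rewrite !inE /= => uv uv' [E E'].
  by have [-> -> ->] := flower_pi_edge_inj uv uv' E E'.
rewrite -(big_imset G h_inj); apply: eq_bigl => -[a b] /=.
apply/existsP/imsetP => [[i /existsP[u /existsP[v /and3P[uv /eqP -> /eqP ->]]]]|].
  by exists (i, (u, v)).
move=> [[i [u v]]]; rewrite inE /= => uv [-> ->]; exists i.
by apply/existsP; exists u; apply/existsP; exists v; rewrite uv !eqxx.
Qed.

Lemma flower_cycle_sum (f : flower_vertex x y n -> R) :
  \sum_i (f (pi i y) - f (pi i x)) = 0.
Proof.
rewrite sumrB; apply/eqP; rewrite subr_eq0; apply/eqP.
rewrite [RHS](reindex_inj (@ordS_inj n)) /=.
by apply: eq_bigr => i _; rewrite flower_pi_glue.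
Qed.

Lemma big_ord_interval (F : nat -> R) (i j : nat) :
  (j <= n)%N ->
  \sum_(k < n | (i <= k < j)%N) F k = \sum_(i <= k < j) F k.
Proof.
move=> jn; rewrite (big_nat_widen _ _ n) // (big_nat_widenl _ 0) // big_mkord.
by apply: eq_bigl => k; rewrite andbC.
Qed.

Lemma flower_path_sum (f : flower_vertex x y n -> R) (i j : 'I_n) :
  (i <= j)%N ->
  \sum_(k < n | (i <= k < j)%N) (f (pi k y) - f (pi k x)) =
  f (pi j x) - f (pi i x).
Proof.
move=> ij.
(* [insubd] allows telescoping over [nat]; its default [i] is never reached, since all indices are
   at most [j]. *)
pose G k := f (pi (insubd i k) x).
have GE (k : 'I_n) : G k = f (pi k x) by rewrite /G valKd.
rewrite -!GE -telescope_sumr // -big_ord_interval ?(ltnW (ltn_ord j)) //.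
apply: eq_bigr => k /andP[_ kj].
rewrite GE flower_pi_glue; congr (f (flower_pi _ _ (_, _)) - _).
have kn : (k.+1 < n)%N by apply: leq_ltn_trans (ltn_ord j).
by apply: val_inj; rewrite /= val_insubd kn modn_small.
Qed.

(** Each petal is shifted to start at the value where the preceding one ends; the zero total drop
    closes the ring. In the proof, [s k] is the resulting value at the copy of [x] in petal [k]. *)
Lemma flower_glue_fun (g : 'I_n -> T -> R) :
  \sum_k (g k y - g k x) = 0 ->
  exists h c, forall k v, h (pi k v) = g k v + c k.
Proof.
move=> g0.
pose s m := \sum_(l < n | (l < m)%N) (g l y - g l x).
pose F (p : 'I_n * T) := g p.1 p.2 + (s p.1 - g p.1 x).
have Fglue k : F (k, y) = F (ordS k, x).
  rewrite /F /= [RHS]addrC subrK.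
  have -> : g k y + (s k - g k x) = s k.+1.
    rewrite addrCA addrC [RHS]/s [RHS](bigD1 k) ?leqnn //=; congr (_ + _).
    by apply: eq_bigl => l; rewrite ltnS ltn_neqAle andbC.
  have [E|E] : (k.+1 < n \/ k.+1 = n)%N by have := ltn_ord k; lia.
    by rewrite modn_small.
  rewrite E modnn /s [RHS]big_pred0 // -[RHS]g0.
  by apply: eq_bigl => l; rewrite ltn_ord.
exists (fun a => F (repr a)), (fun k : 'I_n => s k - g k x) => k v.
by rewrite -/(F (k, v)); apply: (flower_lift Fglue); rewrite /flower_pi reprK.
Qed.

(* A flow of the flower is corrected by a circulation [c * p] around the ring
   so that the potential drops along the ring sum to [0]. *)
Lemma resistance_flower (p : T -> R) (f : 'I_n -> T -> R)
    (a b : flower_vertex x y n) :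
  potential e y x p -> 0 < dirichlet e p p ->
  (forall g : flower_vertex x y n -> R,
     \sum_k dirichlet e (f k) (fun v => g (pi k v)) = g a - g b) ->
  resistance R flower_edge_n a b =
  \sum_k dirichlet e (f k) (f k)
  - (\sum_k dirichlet e (f k) p) ^+ 2 / (n%:R * dirichlet e p p).
Proof.
move=> p_pot r_gt0 f_pot.
set r := dirichlet e p p in r_gt0 *; set S := \sum_k dirichlet e (f k) p.
have nr_neq0 : n%:R * r != 0.
  by rewrite mulf_neq0 ?(lt0r_neq0 r_gt0) // pnatr_eq0 -lt0n (leq_trans _ n3).
(* The circulation changes the total drop around the ring by [n%:R * c * r], which has to cancel
   [S]. *)
pose c := - S / (n%:R * r).
have [|h [k0 hE]] := @flower_glue_fun (fun k v => c * p v + f k v).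
  have drop k : c * p y + f k y - (c * p x + f k x) = c * r + dirichlet e (f k) p.
    by rewrite (dirichletC _ (f k)) p_pot /r p_pot; ring.
  under eq_bigr => k _ do rewrite drop.
  rewrite big_split /= sumr_const card_ord -/S -mulr_natl /c.
  by rewrite mulrCA divfK // addNr.
have hkE k : (fun v => h (pi k v)) = (fun v => c * p v + f k v + k0 k).
  by apply/funext => v; rewrite hE.
have h_pot : potential flower_edge_n a b h.
  move=> g; rewrite dirichlet_flower -f_pot.
  (* The shifts [k0 k] do not affect the form, and the circulation contributes the drops of [g]
     around the ring, which sum to 0. *)
  under eq_bigr => k _ do rewrite hkE dirichlet_affinel p_pot.
  by rewrite big_split /= -mulr_sumr flower_cycle_sum mulr0 add0r.
rewrite (resistance_potential flower_edge_sym h_pot) -f_pot.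
under eq_bigr => k _.
  rewrite hkE dirichletC dirichlet_affinel [dirichlet e p _]dirichletC; over.
rewrite big_split /= -mulr_sumr -/S addrC /c expr2; congr (_ + _).
by rewrite mulrAC !mulNr.
Qed.

End FlowerForm.

Lemma sum_delta (R : pzRingType) (I : finType) (i : I) (F : I -> R) :
  \sum_k (k == i)%:R * F k = F i.
Proof.
rewrite (bigD1 i) //= eqxx mul1r big1 ?addr0 // => k /negPf ->.
by rewrite mul0r.
Qed.

Lemma sum_indicator (R : pzRingType) (I : finType) (P : pred I) (F : I -> R) :
  \sum_k (P k)%:R * F k = \sum_(k | P k) F k.
Proof.
rewrite [RHS]big_mkcond; apply: eq_bigr => k _.
by case: (P k); rewrite ?mul1r ?mul0r.
Qed.

(** * Resistances inside one petal and between two petals *)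

Section FlowerResistance.
Variables (R : realFieldType) (T : finType) (e : rel T) (x y : T) (n : nat).
Hypotheses (e_irr : irreflexive e) (e_sym : symmetric e) (xy : x != y).
Hypothesis n3 : (3 <= n)%N.
Variable p : T -> T -> R.
Hypothesis p_pot : forall u, potential e u x (p u).

Local Notation D := (dirichlet e).
Local Notation pi i v := (@flower_pi T x y n (i, v)).
Local Notation r := (D (p y) (p y)).

(* The length of the leg at [u] in the star (Y-) network equivalent to [G] with
   terminals [x], [y], [u]. *)
Definition leg u := D (p u) (p u) - D (p u) (p y).

Let r_gt0 : 0 < r.
Proof. by apply: (potential_dirichlet_gt0 _ (p_pot y)); rewrite eq_sym. Qed.

Let nr_gt0 : 0 < n%:R * r.
Proof. by rewrite mulr_gt0 // ltr0n (leq_trans _ n3). Qed.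

(** The flow stays in petal [i], and the circulation correction subtracts a nonnegative term. *)
Lemma resistance_same_petal i u v :
  resistance R (@flower_edge T e x y n) (pi i u) (pi i v) <= resistance R e u v.
Proof.
(* The zero term only gives [q] the shape expected by [dirichlet_comb3l]. *)
pose q a := 1 * p u a + (-1) * p v a + 0 * p v a.
have q_pot : potential e u v q.
  by move=> g; rewrite dirichlet_comb3l !p_pot; ring.
pose f k := if k == i then q else fun=> 0.
have sum_f (g : 'I_n -> T -> R) : \sum_k D (f k) (g k) = D q (g i).
  rewrite (bigD1 i) //= /f eqxx big1 ?addr0 // => k /negPf ->.
  exact: dirichlet_cstl.
rewrite (resistance_flower e_irr e_sym xy n3 (p_pot y) r_gt0 (f := f)); last first.
  by move=> g; rewrite sum_f q_pot.
rewrite !sum_f /f eqxx q_pot (resistance_potential e_sym q_pot).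
by rewrite gerBl divr_ge0 ?sqr_ge0 // ltW.
Qed.

(** In the star equivalent to a petal with terminals [x], [y], [u], the arm at [x] has length
    [D (p u) (p y)]. So [s] is the arc between the two star centres, in parallel with the other arc
    [n%:R * r - s]. *)
Lemma resistance_distinct_petals (i j : 'I_n) u v :
  (i < j)%N ->
  let s := (j - i)%:R * r + D (p v) (p y) - D (p u) (p y) in
  resistance R (@flower_edge T e x y n) (pi i u) (pi j v) =
  leg u + leg v + s - s ^+ 2 / (n%:R * r).
Proof.
move=> ij s.
(* A unit flow from [u] to the copy of [x] in petal [i], through petals [i] to [j - 1] from [x] to
   [y], then from the copy of [x] in petal [j] to [v]. *)
pose f (k : 'I_n) a := (k == i)%:R * p u a + - (k == j)%:R * p v a
  + - (i <= k < j)%:R * p y a.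
have sum_f g : \sum_k D (f k) (g k) =
    D (p u) (g i) - D (p v) (g j) - \sum_(k < n | (i <= k < j)%N) D (p y) (g k).
  rewrite -(sum_delta i (fun k => D (p u) (g k))).
  rewrite -(sum_delta j (fun k => D (p v) (g k))).
  rewrite -(sum_indicator (fun k : 'I_n => i <= k < j)%N (fun k => D (p y) (g k))).
  rewrite -!sumrB; apply: eq_bigr => k _.
  by rewrite dirichlet_comb3l !mulNr.
have sum_const (c : R) : \sum_(k < n | (i <= k < j)%N) c = (j - i)%:R * c.
  rewrite (big_ord_interval (fun=> c)) ?(ltnW (ltn_ord j)) //.
  by rewrite sumr_const_nat mulr_natl.
rewrite (resistance_flower e_irr e_sym xy n3 (p_pot y) r_gt0 (f := f)); last first.
  move=> g; rewrite sum_f !p_pot.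
  under eq_bigr do rewrite p_pot.
  by rewrite flower_path_sum ?(ltnW ij) //; ring.
have Dff k : D (p y) (f k) = (k == i)%:R * D (p u) (p y)
    - (k == j)%:R * D (p v) (p y) - (i <= k < j)%:R * r.
  rewrite dirichletC dirichlet_comb3l; ring.
rewrite !sum_f sum_const.
under eq_bigr => k kij.
  rewrite Dff kij (_ : (k == j) = false) ?mul0r ?mul1r ?subr0; last first.
    by apply/negP => /eqP kj; move: kij; rewrite kj ltnn andbF.
  over.
rewrite sumrB sum_const.
rewrite (_ : \sum_(k < n | _) _ = D (p u) (p y)); last first.
  rewrite (bigD1 i) ?leqnn //= eqxx mul1r big1 ?addr0 // => k /andP[_ /negPf ->].
  by rewrite mul0r.
rewrite (dirichletC _ (p u) (f i)) (dirichletC _ (p v) (f j)) !dirichlet_comb3l.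
rewrite !eqxx leqnn ij ltnn andbF -val_eqE (ltn_eqF ij) eq_sym -val_eqE (ltn_eqF ij) /=.
rewrite (dirichletC _ (p y) (p u)) /leg /s.
congr (_ - _ / _); by ring.
Qed.

End FlowerResistance.

(** * Upper and lower bounds on the largest resistance *)

Section MaxResistance.
Variables (R : realFieldType) (T : finType) (e : rel T) (x y : T) (n : nat).
Hypotheses (e_irr : irreflexive e) (e_sym : symmetric e) (xy : x != y).
Hypothesis n3 : (3 <= n)%N.
Variable p : T -> T -> R.
Hypothesis p_pot : forall u, potential e u x (p u).

Local Notation r := (dirichlet e (p y) (p y)).
Local Notation pi i v := (@flower_pi T x y n (i, v)).
Local Notation M := (max_resistance R (@flower_edge T e x y n)).

Let r_gt0 : 0 < r.
Proof. by apply: (potential_dirichlet_gt0 _ (p_pot y)); rewrite eq_sym. Qed.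

Let n_gt0 : 0 < n%:R :> R.
Proof. by rewrite ltr0n (leq_trans _ n3). Qed.

(** The hypothesis on [max_resistance R e] handles pairs in one petal and the neutral element 0 of
    the maximum. *)
Lemma max_resistance_flower_le c :
  (forall u, leg e y p u <= c) ->
  max_resistance R e <= n%:R * r / 4 + 2 * c -> M <= n%:R * r / 4 + 2 * c.
Proof.
move=> leg_c max_e.
have distinct (i j : 'I_n) u v : (i < j)%N ->
    resistance R (@flower_edge T e x y n) (pi i u) (pi j v) <= n%:R * r / 4 + 2 * c.
  move=> ij; rewrite (resistance_distinct_petals e_irr e_sym xy n3 p_pot) //.
  set s := _ * _ + _ - _; set N := n%:R * r.
  have N_gt0 : 0 < N by rewrite mulr_gt0.
  have /= := leg_c u; have /= := leg_c v; move=> lu lv.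
  have : s - s ^+ 2 / N <= N / 4.
    (* Completing the square at [N / 2], where both arcs are equal. *)
    rewrite -subr_ge0 (_ : _ - _ = (s - N / 2) ^+ 2 / N).
      by rewrite divr_ge0 ?sqr_ge0 // ltW.
    by field; rewrite lt0r_neq0.
  lra.
apply: bigmax_le => [|[a b] _] /=.
  by apply: le_trans max_e; apply: bigmax_ge_id.
have [[i u] ->] := flower_pi_surj a; have [[j v] ->] := flower_pi_surj b.
case: (ltngtP i j) => [|ji|/val_inj ->]; first exact: distinct.
  by rewrite resistanceC; apply: distinct.
apply: le_trans (resistance_same_petal e_irr e_sym xy n3 p_pot _ _ _) _.
by apply: le_trans max_e; apply: (le_bigmax _ (fun q => resistance R e q.1 q.2) (u, v)).
Qed.

Lemma max_resistance_flower_ge u :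
  n%:R * r / 4 + 2 * leg e y p u - r / (4 * n%:R) <= M.
Proof.
have n0 : (0 < n)%N by apply: leq_trans n3.
have hn : (n./2 < n)%N by lia.
pose i : 'I_n := Ordinal n0; pose j : 'I_n := Ordinal hn.
have ij : (i < j)%N by rewrite /=; lia.
apply: le_trans (le_bigmax _ (fun q => resistance R _ q.1 q.2) (pi i u, pi j u)).
rewrite /= (resistance_distinct_petals e_irr e_sym xy n3 p_pot) //=.
rewrite subn0 addrK; set m : R := _./2%:R.
have nm : (n%:R - 2 * m) ^+ 2 <= 1.
  rewrite (_ : n%:R - 2 * m = (odd n)%:R).
    by case: (odd n); rewrite ?expr1n // expr0n ler01.
  by rewrite -[in LHS](odd_double_half n) natrD -mul2n natrM addrK.
rewrite -subr_ge0.
(* Here [s] is [m * r], so the exact value falls short of the upper bound only by the parity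
   term. *)
rewrite (_ : _ - _ = r * (1 - (n%:R - 2 * m) ^+ 2) / (4 * n%:R)); last first.
  by field; rewrite (lt0r_neq0 n_gt0) (lt0r_neq0 r_gt0).
apply: divr_ge0; first by apply: mulr_ge0; [exact: ltW | rewrite subr_ge0].
by rewrite mulr_ge0.
Qed.

End MaxResistance.

Theorem theorem3p5 (R : realType) (T : finType) (e : rel T) (x y : T)
    (e_simple : simple_graph e) (e_conn : connected_graph e)
    (xy : x != y) :
  let M : nat -> R :=
    fun n => max_resistance R (@flower_edge T e x y n) in
  (fun n => M n.+1 - M n) @ \oo --> 4^-1 * resistance R e x y.
Proof.
case: e_simple => e_sym e_irr M.
have [p p_pot] := boolp.choice (fun u => @potential_exists R T e e_sym u x e_conn).
rewrite resistanceC // (resistance_potential e_sym (p_pot y)) -(p_pot y (p y)).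
set r := dirichlet e (p y) (p y).
have r_gt0 : 0 < r.
  by apply: (potential_dirichlet_gt0 _ (p_pot y)); rewrite eq_sym.
pose c := leg e y p [arg max_(u > x) leg e y p u]%O.
have leg_c u : leg e y p u <= c by rewrite /c; case: arg_maxP => // w _; apply.
(* The squeeze holds once [n] is large enough for the upper bound to exceed the fixed
   [max_resistance R e]. *)
have a_cvg : (fun n => M n - n%:R * r / 4) @ \oo --> 2 * c.
  apply: (@squeeze_cvgr _ _ _ _ (fun n => 2 * c - r * harmonic n) (fun=> 2 * c)).
  - have big : \forall n \near \oo, 4 / r * (max_resistance R e - 2 * c) <= n%:R.
      exact: nbhs_infty_ger.
    near=> n.
    have n3 : (3 <= n)%N by near: n; exact: nbhs_infty_ge.
    have n_gt0 : 0 < n%:R :> R by rewrite ltr0n (leq_trans _ n3).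
    have max_e : max_resistance R e <= n%:R * r / 4 + 2 * c.
      have : 4 / r * (max_resistance R e - 2 * c) <= n%:R by near: n.
      by rewrite mulrAC ler_pdivrMr //; lra.
    have := max_resistance_flower_le e_irr e_sym xy n3 p_pot leg_c max_e.
    have := max_resistance_flower_ge e_irr e_sym xy n3 p_pot
      [arg max_(u > x) leg e y p u]%O.
    rewrite -/c -/r -/(M n) => lb ub.
    have : r / (4 * n%:R) <= r * harmonic n.
      (* [harmonic n] is the inverse of [n.+1], and [n.+1 <= 4 * n]. *)
      rewrite /= ler_pM2l // lef_pV2 ?posrE ?mulr_gt0 // -natrM ler_nat; lia.
    by move=> hr; apply/andP; split; lra.
  - rewrite -[X in _ --> X]subr0 -[X in _ - X](mulr0 r).
    by apply: cvgB; [exact: cvg_cst | apply: cvgMr; exact: cvg_harmonic].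
  - exact: cvg_cst.
(* The centred terms share a limit and cancel; the linear terms differ by [r / 4]. *)
have -> : (fun n => M n.+1 - M n) =
    (fun n => (M n.+1 - n.+1%:R * r / 4) - (M n - n%:R * r / 4) + 4^-1 * r).
  by apply/funext => n; rewrite -natr1; lra.
rewrite -[X in _ --> X]add0r -[X in _ --> X + _](subrr (2 * c)).
apply: cvgD; last exact: cvg_cst.
apply: cvgB => //.
by rewrite (cvg_shiftS (fun n => M n - n%:R * r / 4)).
Unshelve. all: by end_near.
Qed.
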